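(* Let $\mathbb{K}$ be a commutative field and let $\mathcal{T}$ be an $n$-dimensional reduced non-reflexive linear subspace of $\mathcal{L}(U,V)$, where $U$ and $V$ are finite-dimensional vector spaces over $\mathbb{K}$. Assume that $\#\mathbb{K}>n\geq 3$ and that all the non-zero operators in $\mathcal{T}$ have rank at least $2n-2$. Then there exists an LDB division algebra $(A,\star,\bullet)$ over $\mathbb{K}$ such that $\mathcal{T}$ is equivalent to a (linear) hyperplane of the twisted operator space $\mathcal{T}_{A,\star,\bullet}$ associated with $(A,\star,\bullet)$.
   Context: $\mathcal{L}(U,V)$ is the space of all linear operators from $U$ to $V$. Reduced: a linear subspace $\mathcal{S}$ of $\mathcal{L}(U,V)$ is reduced when $\bigcap_{f\in\mathcal{S}}\operatorname{Ker} f=\{0\}$ and $\sum_{f\in\mathcal{S}}\operatorname{Im} f=V$. Reflexivity: the reflexive closure $\mathcal{R}(\mathcal{S})$ is the set of all $g\in\mathcal{L}(U,V)$ such that $g(x)\in\mathcal{S}x:=\{f(x)\mid f\in\mathcal{S}\}$ for all $x\in U$; $\mathcal{S}$ is (algebraically) reflexive when $\mathcal{S}=\mathcal{R}(\mathcal{S})$, and non-reflexive otherwise. Equivalence: linear subspaces $\mathcal{S}\subset\mathcal{L}(U,V)$ and $\mathcal{S}'\subset\mathcal{L}(U',V')$ are equivalent when there are linear isomorphisms $F:U\to U'$ and $G:V'\to V$ such that $\mathcal{S}=\{G\circ g\circ F\mid g\in\mathcal{S}'\}$. LDB division algebras: a bilinear map $\star:A\times A\to A$ is regular when $a\star b\neq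 0$ for all non-zero $a,b\in A$. A finite-dimensional division algebra $(A,\star)$ over $\mathbb{K}$ is a finite-dimensional $\mathbb{K}$-vector space $A$ with a regular bilinear map $\star:A\times A\to A$ (no associativity or unit is required). A quasi-left-inversion of $\star$ is a map $\bullet:A\times A\to A$ such that $x\bullet y=0$ if and only if $x=0$ or $y=0$, and such that for all $(x,y)\in A^2$ the vectors $x\star(x\bullet y)$ and $y$ are collinear (linearly dependent). A left-division-bilinearizable (LDB) division algebra over $\mathbb{K}$ is a triple $(A,\star,\bullet)$ where $(A,\star)$ is a finite-dimensional division algebra of positive dimension and $\bullet$ is a bilinear quasi-left-inversion of $\star$. Twisted operator space: $\mathcal{T}_{A,\star,\bullet}\subset\mathcal{L}(A^2)$ is the vector space of all endomorphisms of $A^2$ of the form $(y,z)\mapsto(x\star z+\lambda y,\;x\bullet y+\mu z)$ with $(x,\lambda,\mu)\in A\times\mathbb{K}^2$. *)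

(* Defs.v *)
From HB Require Import structures.
From mathcomp Require Import all_boot all_order all_algebra.
Set Implicit Arguments.
Unset Strict Implicit.
Unset Printing Implicit Defensive.
Import GRing.Theory.
Local Open Scope ring_scope.

Section OperatorSpaces.
Variable K : fieldType.

(* The sum of the images runs over a possibly infinite family: a vector belongs
   to it when it belongs to the sum of the images of finitely many operators. *)
Definition reduced (U V : vectType K) (S : {vspace 'Hom(U, V)}) : Prop :=
  (forall x : U, (forall f, f \in S -> x \in lker f) -> x = 0) /\
  (forall y : V, exists2 s : seq 'Hom(U, V),
      {subset s <= S} & y \in (\sum_(f <- s) limg f)%VS).

Definition in_reflexive_closure (U V : vectType K)
    (S : {vspace 'Hom(U, V)}) (g : 'Hom(U, V)) : Prop :=
  forall x : U, exists2 f, f \in S & g x = f x.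

Definition reflexive_space (U V : vectType K) (S : {vspace 'Hom(U, V)}) : Prop :=
  forall g, g \in S <-> in_reflexive_closure S g.

Definition lfun_iso (U V : vectType K) (f : 'Hom(U, V)) : Prop :=
  lker f = 0%VS /\ limg f = fullv.

Definition equivalent_spaces (U V U' V' : vectType K)
    (S : {vspace 'Hom(U, V)}) (S' : {vspace 'Hom(U', V')}) : Prop :=
  exists (F : 'Hom(U, U')) (G : 'Hom(V', V)),
    [/\ lfun_iso F, lfun_iso G
      & forall f, f \in S <-> exists2 g, g \in S' & f = (G \o g \o F)%VF].

Definition hyperplane_of (W : vectType K) (H T : {vspace W}) : Prop :=
  (H <= T)%VS /\ \dim T = (\dim H).+1.

Definition regular_product (A : vectType K) (star : A -> A -> A) : Prop :=
  forall a b, a != 0 -> b != 0 -> star a b != 0.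

Definition quasi_left_inversion (A : vectType K) (star bullet : A -> A -> A) :
    Prop :=
  (forall x y, bullet x y = 0 <-> x = 0 \/ y = 0) /\
  (forall x y, ~~ free [:: star x (bullet x y); y]).

Record ldb_division_algebra := LDBDivisionAlgebra {
  ldb_carrier : vectType K;
  ldb_star : {bilinear ldb_carrier -> ldb_carrier -> ldb_carrier};
  ldb_bullet : {bilinear ldb_carrier -> ldb_carrier -> ldb_carrier};
  ldb_dim_gt0 : (0 < \dim {: ldb_carrier})%N;
  ldb_star_regular : regular_product ldb_star;
  ldb_quasi_inversion : quasi_left_inversion ldb_star ldb_bullet
}.

End OperatorSpaces.

Section TwistedOperatorSpace.
Variables (K : fieldType) (D : ldb_division_algebra K).
Local Notation A := (ldb_carrier D).
Local Notation star := (ldb_star D).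
Local Notation bullet := (ldb_bullet D).

Definition twisted_fun (p : A * (K^o * K^o)) (w : A * A) : A * A :=
  (star p.1 w.2 + (p.2.1 : K) *: w.1, bullet p.1 w.1 + (p.2.2 : K) *: w.2).

Fact twisted_fun_is_linear p : linear (twisted_fun p).
Proof.
move=> a [y z] [y' z']; rewrite /twisted_fun /=; congr (_, _) => /=;
  by rewrite linearPr /= scalerDr !scalerDr !scalerA [_ * a]mulrC addrACA.
Qed.

HB.instance Definition _ p :=
  GRing.isLinear.Build K (A * A)%type (A * A)%type *:%R
    (twisted_fun p) (twisted_fun_is_linear p).

Definition twisted_op (p : A * (K^o * K^o)) : 'End((A * A)%type) :=
  linfun (twisted_fun p).

Fact twisted_op_is_linear : linear twisted_op.
Proof.
move=> a [x [l m]] [x' [l' m']]; apply/lfunP => -[y z].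
rewrite add_lfunE scale_lfunE !lfunE /twisted_fun /=; congr (_, _) => /=;
  by rewrite linearPl /= scalerDl scalerDr scalerA addrACA.
Qed.

HB.instance Definition _ :=
  GRing.isLinear.Build K (A * (K^o * K^o))%type 'End((A * A)%type) *:%R
    twisted_op twisted_op_is_linear.

Definition twisted_space : {vspace 'End((A * A)%type)} := limg (linfun twisted_op).

Lemma twisted_spaceP (f : 'End((A * A)%type)) :
  f \in twisted_space <->
  exists (x : A) (l m : K), forall y z : A,
    f (y, z) = (star x z + l *: y, bullet x y + m *: z).
Proof.
split=> [/memv_imgP [[x [l m]] _ ->]|[x [l [m fE]]]].
  by exists x, l, m => y z; rewrite !lfunE.
apply/memv_imgP; exists (x, ((l : K^o), (m : K^o))); first exact: memvf.
by rewrite lfunE /=; apply/lfunP => -[y z]; rewrite fE lfunE.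
Qed.

End TwistedOperatorSpace.

(* Main.v *)
(* Take h in the reflexive closure of T but not in T. A vector x on which T acts
   injectively exists, and subtracting an element of T from h gives f with
   f x = 0. For every y and every scalar c, some non-zero element of T + <f> kills
   c x + y; expanding the corresponding determinant in c gives f y = (phi y) x,
   (phi y) y = (psi y) x and (psi y) y in T x, with phi y and psi y in T. Modulo
   T x, the form (phi y) z is therefore alternating on W = phi(U), and comparing
   its rank with the lower bound 2n - 2 gives rank f = dim W = n - 1 and
   W(ker f) <= im f. Another generic vector yields a second operator g with f - g
   in T and the same properties. As f - g has rank at least 2n - 2, U is the sum
   of ker g and ker f and im f meets im g trivially; the operators w in T + <f>
   with w(ker f) <= im f and w(ker g) <= im g form a space of dimension n - 1, and
   with f and g they span T + <f>. In these block decompositions T + <f> is the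
   twisted operator space of an LDB division algebra. *)
From HB Require Import structures.
Require Import Defs.
From mathcomp Require Import all_boot all_order all_algebra.
From mathcomp Require Import perm zify.
From Stdlib Require Import Classical.
Set Implicit Arguments.
Unset Strict Implicit.
Unset Printing Implicit Defensive.
Import GRing.Theory.
Local Open Scope ring_scope.

(** * Degenerate bordered matrix pencils *)

(** Each term of the Leibniz expansion takes one entry per row, so row degrees add up. Counting by
    rows lets the constant last row of the bordered pencil contribute nothing, which keeps the
    degree at n for a matrix of size n + 1. *)
Lemma size_det_leq (R : idomainType) (n : nat) (M : 'M[{poly R}]_n)
    (r : 'I_n -> nat) :
  (forall i j, size (M i j) <= (r i).+1)%N ->
  (size (\det M) <= (\sum_i r i).+1)%N.
Proof.
move=> leM; apply: leq_trans (size_sum _ _ _) _; apply/bigmax_leqP => s _.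
rewrite -signr_odd mulr_sign (fun_if (fun p : {poly R} => size p)) size_polyN if_same.
apply: leq_trans (size_poly_prod_leq _ _) _.
have le_sum : (\sum_(i < n) size (M i (s i)) <= \sum_(i < n) (r i + 1))%N.
  by apply: leq_sum => i _; rewrite addn1.
move: le_sum; rewrite big_split /= sum_nat_const !card_ord muln1.
by rewrite leq_subLR addnS ltnS addnC.
Qed.

Section Pencil.
Variables (K : fieldType) (n : nat) (A : 'M[K]_n).

(* The rows [t i] and scalars [a i] are the coefficients of a polynomial vector
   killed by the pencil, multiplied by 'X^3 so that the top three coefficients
   can be compared without treating low degrees separately. *)
Lemma pencil_kernel (b : 'cV[K]_n) (C : 'rV[K]_n) (d : K) (s : seq K) :
    uniq s -> (n < size s)%N ->
    (forall c, c \in s -> \det (block_mx (c%:M + A) b C d%:M) = 0) ->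
  exists (t : nat -> 'rV[K]_n) (a : nat -> K) (e : nat),
    [/\ (forall i, t i + t i.+1 *m A + a i.+1 *: C = 0),
        (forall i, t i *m b + (a i * d)%:M = 0),
        (a e.+2 != 0) & forall i, (e.+2 <= i)%N -> t i = 0 /\ a i.+1 = 0].
Proof.
move=> s_uniq s_big det0.
set M : 'M[{poly K}]_(n + 1) :=
  block_mx ('X%:M + map_mx polyC A) (map_mx polyC b) (map_mx polyC C) (d%:P)%:M.
have szM : (size (\det M) <= n.+1)%N.
  pose r (i : 'I_(n + 1)) : nat := (i < n)%N.
  have sum_r : (\sum_i r i)%N = n.
    rewrite /r big_split_ord /= big_ord1 /= addn0 ltnn addn0.
    rewrite (eq_bigr (fun=> 1%N)) => [|i _]; last by rewrite ltn_ord.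
    by rewrite sum_nat_const card_ord muln1.
  rewrite -[X in (_ <= X.+1)%N]sum_r; apply: size_det_leq => i j; rewrite /r /M.
  case: (split_ordP i) => i' ->; case: (split_ordP j) => j' -> /=;
    rewrite ?block_mxEul ?block_mxEur ?block_mxEdl ?block_mxEdr !mxE ?ltn_ord.
  - apply: leq_trans (size_polyD _ _) _; rewrite geq_max.
    rewrite (leq_trans (size_polyC_leq1 _)) // andbT.
    by case: (i' == j'); rewrite ?mulr1n ?mulr0n ?size_polyX ?size_poly0.
  - exact: leq_trans (size_polyC_leq1 _) _.
  - exact: leq_trans (size_polyC_leq1 _) _.
  - rewrite !ord1 eqxx mulr1n; exact: leq_trans (size_polyC_leq1 _) _.
have detM0 : \det M = 0.
  apply: (roots_geq_poly_eq0 (rs := s)) => //; last exact: leq_trans szM _.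
  apply/allP => c cs; rewrite /root -horner_evalE -det_map_mx /M map_block_mx.
  have evC m p (B : 'M[K]_(m, p)) : map_mx (horner_eval c) (map_mx polyC B) = B.
    by apply/matrixP => i j; rewrite !mxE horner_evalE hornerC.
  by rewrite map_mxD /= !map_scalar_mx /= !horner_evalE hornerX hornerC !evC det0.
have [v v_neq0 vM] := det0P (introT eqP detM0).
pose u := 'X^3 *: v.
have u_neq0 : u != 0 by rewrite scalemx_eq0 expf_eq0 /= polyX_eq0.
have {vM} : u *m M = 0 by rewrite -scalemxAl vM scaler0.
have u3 i j : (i < 3)%N -> (u 0 j)`_i = 0 by move=> i3; rewrite mxE mulrC coefMXn i3.
move: u_neq0 u3; rewrite -[u]hsubmxK; move: (lsubmx u) (rsubmx u) => {u} tp ap.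
rewrite [ap]mx11_scalar; move: (ap 0 0) => {}ap u_neq0 u3.
rewrite /M mul_row_block -row_mx0 => /eq_row_mx [E1 E2].
pose t i : 'rV[K]_n := \row_j (tp 0 j)`_i.
pose a i := ap`_i.
exists t, a.
have t1 i : t i + t i.+1 *m A + a i.+1 *: C = 0.
  apply/rowP => j; move: (congr1 (fun B : 'rV[{poly K}]_n => (B 0 j)`_i.+1) E1).
  rewrite mulmxDr mul_mx_scalar mul_scalar_mx !mxE !coefD coefXM coef0 /= => E.
  rewrite -[RHS]E; congr (_ + _ + _).
    by rewrite coef_sum; apply: eq_bigr => k _; rewrite !mxE coefMC.
  by rewrite coefMC.
have t2 i : t i *m b + (a i * d)%:M = 0.
  apply/rowP => j; move: (congr1 (fun B : 'rV[{poly K}]_1 => (B 0 j)`_i) E2).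
  rewrite !ord1 mul_scalar_mx !mxE !coefD coef_sum eqxx !mulr1n coefMC coef0 => E.
  rewrite -[RHS]E; congr (_ + _); apply: eq_bigr => k _.
  by rewrite !mxE coefMC.
pose N := (\max_j size (tp 0%R j))%N.
have tN i : (N <= i)%N -> t i = 0.
  move=> Ni; apply/rowP => j; rewrite !mxE nth_default //.
  by apply: leq_trans Ni; apply: (@leq_bigmax _ (fun j => size (tp 0 j))).
(* The kernel vector has its strictly highest degree in the last entry: beyond the degree of [ap]
   the recurrence [t1] reads [t i = - t i.+1 *m A], and [t] vanishes far out. *)
have t0 i : (size ap <= i.+1)%N -> t i = 0.
  move=> ile; have [k Nk] : exists k, (N <= i + k)%N by exists N; rewrite leq_addl.
  elim: k i ile Nk => [|k IH] i ile Nk; first by rewrite tN // -[i]addn0.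
  have := t1 i; rewrite (IH i.+1) ?(leq_trans ile) ?addSnnS //.
  by rewrite mul0mx addr0 /a nth_default // scale0r addr0.
have ap_neq0 : ap != 0.
  apply: contraNneq u_neq0 => ap0; apply/eqP/rowP => j; rewrite ap0 in t0 *.
  case: (split_ordP j) => j' ->; rewrite ?row_mxEl ?row_mxEr ?mxE ?mul0rn //.
  apply/polyP => i; have := congr1 (fun B : 'rV[K]_n => B 0 j') (t0 i _).
  by rewrite !mxE coef0; apply; rewrite size_poly0.
have ap3 i : (i < 3)%N -> ap`_i = 0.
  by move=> i3; have := u3 i (rshift n 0) i3; rewrite row_mxEr mxE eqxx mulr1n.
have sz_ap : (3 < size ap)%N.
  rewrite ltnNge; apply: contra ap_neq0 => sz3; apply/eqP/polyP => i.
  rewrite coef0; case: (ltnP i 3) => [/ap3 //|i3].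
  by rewrite nth_default // (leq_trans sz3).
(* Thus [e.+2] is the degree of [ap]; the factor 'X^3 makes that degree at least 3, so the
   subtraction is exact. *)
exists (size ap - 3)%N; split => //.
  rewrite /a (_ : _.+2 = (size ap).-1); last by lia.
  by rewrite -lead_coefE lead_coef_eq0.
move=> i ile; have lei : (size ap <= i.+1)%N by lia.
by split; [apply: t0 | apply: nth_default].
Qed.

(** By the Schur complement the determinant is that of c + A times d - C (c + A)^-1 b, and d, C b, C
    A b are up to sign the first coefficients of this factor in 1/c. The polynomial kernel vector
    replaces the expansion: its top coefficients give the three equalities in turn. *)
Lemma pencil_coef (b : 'cV[K]_n) (C : 'rV[K]_n) (d : K) (s : seq K) :
    uniq s -> (n < size s)%N ->
    (forall c, c \in s -> \det (block_mx (c%:M + A) b C d%:M) = 0) ->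
  [/\ d = 0, C *m b = 0 & C *m A *m b = 0].
Proof.
move=> s_uniq s_big det0.
have [t [a [e [t1 t2 ae t0]]]] := pencil_kernel s_uniq s_big det0.
have d0 : d = 0.
  have := t2 e.+2; rewrite (t0 e.+2 _).1 // mul0mx add0r.
  move=> /matrixP/(_ 0 0); rewrite !mxE eqxx mulr1n => /eqP.
  by rewrite mulf_eq0 (negPf ae) => /eqP.
have tb i : t i *m b = 0 by rewrite -[RHS](t2 i) d0 mulr0 raddf0 addr0.
have te1 : t e.+1 = - (a e.+2 *: C).
  apply/eqP; rewrite -addr_eq0; have := t1 e.+1.
  by rewrite (t0 e.+2 _).1 // mul0mx addr0 => ->.
have Cb : C *m b = 0.
  apply: (scalerI ae); rewrite scalemxAl -[_ *: C]opprK -te1.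
  by rewrite mulNmx tb oppr0 scaler0.
split=> //.
apply: (scalerI ae); rewrite scaler0 !scalemxAl -[_ *: C]opprK -te1 !mulNmx.
have /(congr1 (mulmx^~ b)) := t1 e.
by rewrite !mulmxDl tb -scalemxAl Cb scaler0 addr0 add0r mul0mx => ->; rewrite oppr0.
Qed.
End Pencil.

(** * Evaluation at a vector and existence of separating vectors *)

Lemma lfun_retraction (K : fieldType) (E F : vectType K) (X : {vspace E})
    (h : 'Hom(E, F)) :
  (X :&: lker h = 0)%VS ->
  exists pi : 'Hom(F, E), (forall v, pi v \in X) /\ {in X, cancel h pi}.
Proof.
move=> Xh; pose g : 'Hom(subvs_of X, F) := (h \o linfun (@vsval _ _ X))%VF.
have g_inj : lker g == 0%VS.
  apply/lker0P => u v; rewrite !comp_lfunE !lfunE /= => /eqP.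
  rewrite -subr_eq0 -linearB -memv_ker => uv; apply/eqP; rewrite -subr_eq0.
  suff : vsval (u - v) \in (X :&: lker h)%VS.
    by rewrite Xh memv0 -(linear0 (@vsval _ _ X)) (inj_eq (@subvs_inj _ _ X)).
  by rewrite memv_cap subvsP linearB.
exists (linfun (@vsval _ _ X) \o g^-1)%VF; split=> [v|t tX].
  by rewrite comp_lfunE lfunE subvsP.
have -> : h t = g (vsproj X t) by rewrite comp_lfunE lfunE /= vsprojK.
by rewrite comp_lfunE lker0_lfunK // lfunE /= vsprojK.
Qed.

Lemma dimv_add_line (K : fieldType) (E : vectType K) (W : {vspace E}) (h : E) :
  h \notin W -> \dim (W + <[h]>)%VS = (\dim W).+1.
Proof.
move=> hW; rewrite dimv_disjoint_sum ?dim_vline.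
  by rewrite (_ : h != 0) ?addn1 //; apply: contraNneq hW => ->; rewrite mem0v.
apply/eqP; rewrite -subv0; apply/subvP => u; rewrite memv_cap => /andP[uW].
case/vlineP => c uE; have [c0|c0] := eqVneq c 0; first by rewrite uE c0 scale0r mem0v.
by case/negP: hW; rewrite -[h](scalerK c0) -uE memvZ.
Qed.

Section Evaluation.
Variables (K : fieldType) (U V : vectType K).

Definition eval_at (x : U) (t : 'Hom(U, V)) : V := t x.

Fact eval_at_is_linear x : linear (eval_at x).
Proof. by move=> a t t'; rewrite /eval_at add_lfunE scale_lfunE. Qed.

HB.instance Definition _ x :=
  GRing.isLinear.Build K 'Hom(U, V) V *:%R (eval_at x) (eval_at_is_linear x).

Definition ev (x : U) : 'Hom('Hom(U, V), V) := linfun (eval_at x).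

Lemma evE x t : ev x t = t x. Proof. by rewrite lfunE. Qed.

Definition separating (T : {vspace 'Hom(U, V)}) (x : U) :=
  forall t, t \in T -> t x = 0 -> t = 0.

Lemma separatingP (T : {vspace 'Hom(U, V)}) x :
  separating T x <-> (T :&: lker (ev x) = 0)%VS.
Proof.
split=> [sepT|Tx t tT tx].
  apply/eqP; rewrite -subv0; apply/subvP => t; rewrite memv_cap memv_ker evE memv0.
  by case/andP=> tT /eqP/(sepT t tT) ->.
by apply/eqP; rewrite -memv0 -Tx memv_cap tT memv_ker evE tx eqxx.
Qed.

Lemma eval_retraction (T : {vspace 'Hom(U, V)}) x : separating T x ->
  exists pi : 'Hom(V, 'Hom(U, V)),
    (forall v, pi v \in T) /\ (forall t, t \in T -> pi (t x) = t).
Proof.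
move/separatingP/lfun_retraction => [pi [piT piK]].
by exists pi; split=> // t tT; rewrite -evE piK.
Qed.

Section Jet.
Variables (T : {vspace 'Hom(U, V)}) (x : U) (pi : 'Hom(V, 'Hom(U, V))).
Hypotheses (piT : forall v, pi v \in T) (piK : forall t, t \in T -> pi (t x) = t).

(* Its kernel is T x, so [residue v = 0] is the linear way to say [v \in T x]. *)
Definition residue : 'End(V) := \1%VF - (ev x \o pi)%VF.

Lemma residueE v : residue v = v - (pi v) x.
Proof. by rewrite add_lfunE opp_lfunE comp_lfunE evE id_lfunE. Qed.

Lemma residue_eval t : t \in T -> residue (t x) = 0.
Proof. by move=> tT; rewrite residueE piK // subrr. Qed.

Lemma residue_eq0 v : residue v = 0 -> v = (pi v) x.
Proof. by rewrite residueE => /eqP; rewrite subr_eq0 => /eqP. Qed.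

Definition coord_row (t : 'Hom(U, V)) : 'rV[K]_(\dim T) :=
  \row_i coord (vbasis T) i t.

Lemma coord_row_sum t : t \in T -> t = \sum_i coord_row t 0 i *: (vbasis T)`_i.
Proof.
by move=> tT; rewrite {1}(coord_vbasis tT); apply: eq_bigr => i _; rewrite mxE.
Qed.

Lemma coord_row_eq0 t : t \in T -> coord_row t = 0 -> t = 0.
Proof.
move=> tT t0; rewrite (coord_row_sum tT) t0 big1 // => i _.
by rewrite mxE scale0r.
Qed.

(** The endomorphism of T sending t to [pi (t y)], acting on coordinate rows from the right. *)
Definition eval_mx (y : U) : 'M[K]_(\dim T) :=
  \matrix_(j, i) coord (vbasis T) i (pi ((vbasis T)`_j y)).

Lemma coord_row_eval_mx y t : t \in T -> coord_row t *m eval_mx y = coord_row (pi (t y)).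
Proof.
move=> tT; apply/rowP => i; rewrite {2}(coord_row_sum tT) sum_lfunE !mxE linear_sum /=.
rewrite (linear_sum (coord (vbasis T) i)) /=.
by apply: eq_bigr => j _; rewrite !mxE scale_lfunE linearZ /= linearZ.
Qed.

(* The hypothesis makes the pencil [c x + y] degenerate on [T + <f>] for every
   scalar c; these are the first three coefficients of the degeneracy in 1/c. *)
Lemma jet_conditions (f : 'Hom(U, V)) (s : seq K) :
    f x = 0 -> uniq s -> (\dim T < size s)%N ->
    (forall u, exists t a,
        [/\ t \in T, (t != 0) || (a != 0) & t u + a *: f u = 0]) ->
  forall y, [/\ residue (f y) = 0, residue (pi (f y) y) = 0
              & residue (pi (pi (f y) y) y) = 0].
Proof.
move=> fx0 s_uniq s_big dep y.
pose rv := coord_row; pose A := eval_mx y.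
have rvA t : t \in T -> rv t *m A = rv (pi (t y)) by exact: coord_row_eval_mx.
(* The residue is tested one coordinate at a time: each linear form [l] vanishing on T x borders the
   pencil with a single column. *)
suff key : forall k, let l v := coord (vbasis {:V}) k (residue v) in
    [/\ l (f y) = 0, l (pi (f y) y) = 0 & l (pi (pi (f y) y) y) = 0].
  have res0 v : (forall k, coord (vbasis {:V}) k (residue v) = 0) -> residue v = 0.
    move=> v0; rewrite (coord_vbasis (memvf (residue v))) big1 // => k _.
    by rewrite v0 scale0r.
  by split; apply: res0 => k; have [] := key k.
move=> k l.
have lD u v : l (u + v) = l u + l v by rewrite /l !linearD.
have lZ c v : l (c *: v) = c * l v by rewrite /l !linearZ.
have lT t : t \in T -> l (t x) = 0 by move=> tT; rewrite /l residue_eval // linear0.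
pose b : 'cV[K]_(\dim T) := \col_j l ((vbasis T)`_j y).
have rvb t : t \in T -> rv t *m b = (l (t y))%:M.
  move=> tT; apply/rowP => i; rewrite {2}(coord_row_sum tT) sum_lfunE !ord1 !mxE eqxx.
  rewrite /l linear_sum /= linear_sum /= mulr1n; apply: eq_bigr => j _.
  by rewrite !mxE scale_lfunE linearZ /= linearZ.
(* If t + a f kills c x + y, then c t(x) + t(y) + a f(y) = 0 because f x = 0. Applying [pi] and then
   [l] to this equation shows that the row of t and a lies in the kernel of the bordered matrix. *)
have det0 c : c \in s ->
    \det (block_mx (c%:M + A) b (rv (pi (f y))) (l (f y))%:M) = 0.
  move=> _; apply/eqP/det0P; have [t [a [tT ta E]]] := dep (c *: x + y).
  exists (row_mx (rv t) a%:M).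
    apply: contraTneq ta; rewrite -row_mx0 => /eq_row_mx [rt0 a0].
    have -> : a = 0 by have /matrixP/(_ 0 0) := a0; rewrite !mxE eqxx mulr1n.
    by rewrite (coord_row_eq0 tT rt0) !eqxx.
  have {E} E : c *: t x + t y + a *: f y = 0.
    by rewrite -E !linearD !linearZ /= fx0 !scaler0 add0r.
  rewrite mul_row_block mulmxDr rvA // rvb // mul_mx_scalar !mul_scalar_mx -row_mx0.
  congr row_mx.
    have /(congr1 (rv \o pi)) /= := E.
    rewrite !linearD !linearZ /= piK // => E'.
    rewrite -[RHS](_ : rv 0 = 0); last by apply/rowP => i; rewrite !mxE linear0.
    rewrite -(linear0 pi) -E'.
    by apply/rowP => i; rewrite !mxE !linearD !linearZ.
  apply/rowP => i; rewrite !ord1 !mxE eqxx !mulr1n.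
  have /(congr1 l) := E; rewrite !lD !lZ lT // mulr0 add0r => ->.
  by rewrite /l !linear0.
have [-> E1 E2] := pencil_coef s_uniq s_big det0.
have scal0 (c : K) : (c%:M : 'M_1) = 0 -> c = 0.
  by move=> /matrixP/(_ 0 0); rewrite !mxE eqxx mulr1n.
split=> //; apply: scal0; first by rewrite -rvb.
by rewrite -rvb // -(rvA (pi (f y))).
Qed.

(** The vector c x + u fails to separate T only when - c is an eigenvalue of [eval_mx u], which
    excludes at most dim T scalars. *)
Lemma separating_pencil (u : U) (s : seq K) :
  uniq s -> (\dim T < size s)%N -> exists c, separating T (c *: x + u).
Proof.
move=> s_uniq s_big.
have char_neq0 : char_poly (eval_mx u) != 0 by rewrite monic_neq0 ?char_poly_monic.
have /allPn[_ /mapP[c _ ->] not_root] :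
    ~~ all (root (char_poly (eval_mx u))) [seq - c | c <- s].
  apply: contraTN s_big => /(max_poly_roots char_neq0).
  rewrite (map_inj_uniq oppr_inj) size_map size_char_poly ltnS -leqNgt.
  by apply.
exists c => t tT tcu; apply: (coord_row_eq0 tT); apply/eqP.
apply: contraNT not_root => t_neq0; rewrite -eigenvalue_root_char.
apply/eigenvalueP; exists (coord_row t) => //; rewrite coord_row_eval_mx //.
have {tcu} : c *: t + pi (t u) = 0.
  by have /(congr1 pi) := tcu; rewrite !linearD !linearZ /= piK // linear0.
rewrite addrC => /eqP; rewrite addr_eq0 => /eqP ->.
by apply/rowP => i; rewrite !mxE -scaleNr linearZ.
Qed.

End Jet.

(** Induction on subspaces S of T that have a separating vector x. If S + <t> had none, some
    non-zero f in S + <t> would vanish at x, and the first jet condition would put [limg f] inside S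
    x, whose dimension is smaller than dim T: this contradicts the rank bound. *)
Lemma exists_separating (T : {vspace 'Hom(U, V)}) (s : seq K) :
    uniq s -> (\dim T < size s)%N ->
    (forall t, t \in T -> t != 0 -> (\dim T <= \dim (limg t))%N) ->
  exists x, separating T x.
Proof.
move=> s_uniq s_big rankT.
suff [S [ST dimS [x sepS]]] : exists S : {vspace 'Hom(U, V)},
    [/\ (S <= T)%VS, \dim S = \dim T & exists x, separating S x].
  by exists x; rewrite (_ : T = S) //; apply/eqP; rewrite eq_sym eqEdim ST dimS /=.
move: (leqnn (\dim T)); move: {1 3}(\dim T) => r.
elim: r => [_|r IH r_lt].
  by exists 0%VS; rewrite sub0v dimv0; split=> //; exists 0 => t; rewrite memv0 => /eqP.
have [S [ST dimS [x sepS]]] := IH (ltnW r_lt).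
have [pi [piS piK]] := eval_retraction sepS.
have /subvPn[t tT tS] : ~~ (T <= S)%VS.
  by apply/negP => /dimvS; rewrite dimS leqNgt r_lt.
have dimSt : \dim (S + <[t]>)%VS = r.+1 by rewrite dimv_add_line ?dimS.
have StT : (S + <[t]> <= T)%VS by rewrite subv_add ST -memvE.
exists (S + <[t]>)%VS; split=> //; apply: NNPP => nsep.
have dep u : exists t' a, [/\ t' \in S, (t' != 0) || (a != 0) & t' u + a *: t u = 0].
  have : ((S + <[t]>) :&: lker (ev u) != 0)%VS.
    by apply/eqP => E; apply: nsep; exists u; apply/separatingP.
  rewrite -vpick0; have := memv_pick ((S + <[t]>) :&: lker (ev u))%VS.
  rewrite memv_cap memv_ker evE => /andP[/memv_addP[t' t'S [_ /vlineP[a ->] ->]]].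
  rewrite add_lfunE scale_lfunE => /eqP E nz; exists t', a; split=> //.
  apply: contraNT nz; rewrite negb_or !negbK => /andP[/eqP -> /eqP ->].
  by rewrite scale0r addr0.
have [t' [a [t'S nz E]]] := dep x.
have a_neq0 : a != 0.
  apply: contraTneq nz => a0; move: E; rewrite a0 scale0r addr0 => /(sepS _ t'S) ->.
  by rewrite !eqxx.
pose f := t' + a *: t.
have fx0 : f x = 0 by rewrite add_lfunE scale_lfunE.
have f_neq0 : f != 0.
  apply: contraNneq tS; rewrite /f addrC => /eqP; rewrite addr_eq0 => /eqP at'.
  by rewrite -[t](scalerK a_neq0) at' memvZ // memvN.
have fT : f \in T by rewrite memvD ?memvZ // (subvP ST).
(* Since f = t' + a t, the dependency t1 + b t is rewritten as t1 - (b / a) t' + (b / a) f. *)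
have depf u : exists t1 b, [/\ t1 \in S, (t1 != 0) || (b != 0) & t1 u + b *: f u = 0].
  have [t1 [b [t1S nzb Eb]]] := dep u; exists (t1 - (b / a) *: t'), (b / a); split.
  - by rewrite memvB ?memvZ.
  - have [b0|b0] := eqVneq b 0; last by rewrite mulf_neq0 ?invr_eq0 ?orbT.
    by move: nzb; rewrite b0 eqxx mul0r scale0r subr0 orbF => ->.
  - rewrite -Eb !add_lfunE !opp_lfunE !scale_lfunE scalerDr scalerA divfK // addrA.
    by rewrite subrK.
have s_bigS : (\dim S < size s)%N by rewrite dimS (ltn_trans r_lt).
have jet y := jet_conditions piS piK fx0 s_uniq s_bigS depf y.
have : (\dim (limg f) <= \dim (ev x @: S))%N.
  apply: dimvS; apply/subvP => v /memv_imgP[y _ ->].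
  by have [/residue_eq0 -> _ _] := jet y; rewrite -evE memv_img.
rewrite leqNgt => /negP; apply.
apply: leq_trans (rankT f fT f_neq0); apply: leq_ltn_trans r_lt.
by rewrite -dimS -(limg_ker_dim (ev x) S) leq_addl.
Qed.

End Evaluation.

(** * The alternating form attached to an operator vanishing at a separating vector *)

Lemma rank_leq_img (K : fieldType) (U V : vectType K) (w : 'Hom(U, V))
    (M : {vspace U}) :
  (\dim (limg w) <= \dim (w @: M) + (\dim {:U} - \dim M))%N.
Proof.
rewrite -(addv_complf M) limgD (leq_trans (dimv_leqif_sup (subvv _))) //.
apply: leq_trans (dimv_add_leqif _ _) _; rewrite leq_add2l addv_complf -dimv_compl.
by rewrite -(limg_ker_dim w M^C) leq_addl.
Qed.

(* [lia] only identifies syntactically equal atoms; [set] identifies the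
   dimensions up to conversion. *)
Ltac dimlia :=
  repeat match goal with
  | |- context [@dimv ?K ?v ?A] =>
      let d := fresh "d" in set d := (@dimv K v A); clearbody d
  end;
  match goal with H : is_true (3 <= _)%N |- _ => move: H end; clear; lia.

Section LocalStructure.
Variables (K : fieldType) (U V : vectType K) (T : {vspace 'Hom(U, V)}) (n : nat).
Hypotheses (dimT : \dim T = n) (n_ge3 : (3 <= n)%N).
Hypothesis rankT :
  forall t, t \in T -> t != 0 -> (2 * n - 2 <= \dim (limg t))%N.
Variables (x : U) (pi : 'Hom(V, 'Hom(U, V))).
Hypotheses (piT : forall v, pi v \in T) (piK : forall t, t \in T -> pi (t x) = t).
Variable R : 'End(V).
Hypothesis R_eq0 : forall v, R v = 0 -> v = pi v x.
Variable f : 'Hom(U, V).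
Hypotheses (fx0 : f x = 0) (f_neq0 : f != 0).
Hypothesis jet1 : forall y, R (f y) = 0.
Hypothesis jet2 : forall y, R (pi (f y) y) = 0.
Hypothesis jet3 : forall y, R (pi (pi (f y) y) y) = 0.

Variable phi : 'Hom(U, 'Hom(U, V)).
Hypothesis phiE : forall y, phi y = pi (f y).
Let W := limg phi.
(** The orthogonal of z in W for the V-valued form [R (phi y z)], which is skew in y and z. *)
Let N z := (W :&: lker (R \o ev V z))%VS.

Let fE y : f y = phi y x. Proof. by rewrite phiE -R_eq0. Qed.

Let phi_eq0 y : (phi y == 0) = (f y == 0).
Proof.
apply/eqP/eqP => [py|fy]; first by rewrite fE py zero_lfunE.
by rewrite phiE fy linear0.
Qed.

Let WT : (W <= T)%VS.
Proof. by apply/subvP => t /memv_imgP[y _ ->]; rewrite phiE. Qed.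

Let dimW : \dim W = \dim (limg f).
Proof.
have -> : W = (pi @: limg f)%VS.
  by rewrite -limg_comp; congr (_ @: _)%VS; apply/lfunP => y; rewrite comp_lfunE phiE.
rewrite limg_dim_eq //; apply/eqP; rewrite -subv0; apply/subvP => v.
rewrite memv_cap memv_ker memv0 => /andP[/memv_imgP[y _ ->]].
by rewrite -phiE phi_eq0.
Qed.

Let in_W t : t \in W -> exists z, phi z = t.
Proof. by case/memv_imgP => z _ ->; exists z. Qed.

(* Polarisation of [jet2]. *)
Let jet2_skew y z : R (phi y z) = - R (phi z y).
Proof.
have := jet2 (y + z); rewrite !linearD /= -!phiE !add_lfunE !linearD /=.
rewrite !phiE !jet2 add0r addr0 => /eqP; rewrite addr_eq0 => /eqP ->.
by rewrite opprK.
Qed.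

(** By skewness, since [phi k = 0]: the kernel of f lies in the radical of the form. *)
Let W_ker t k : t \in W -> f k = 0 -> R (t k) = 0.
Proof.
case/in_W => z <- fk; rewrite jet2_skew.
have /eqP -> : phi k == 0 by rewrite phi_eq0 fk.
by rewrite zero_lfunE linear0 oppr0.
Qed.

Let mem_N z t : (t \in N z) = (t \in W) && (R (t z) == 0).
Proof. by rewrite memv_cap memv_ker comp_lfunE evE. Qed.

Let self_N z : phi z \in N z.
Proof. by rewrite mem_N memv_img ?memvf //= phiE jet2. Qed.

(** By skewness, evaluating W at z modulo T x has the same image as [R \o phi z]. The kernel of R
    lies in T x, of dimension n, so this image has dimension at least (2n - 2) - n. *)
Let dim_N z : phi z != 0 -> (\dim (N z) + (n - 2) <= \dim W)%N.
Proof.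
move=> pz; rewrite -(limg_ker_dim (R \o ev V z) W) leq_add2l.
have -> : ((R \o ev V z) @: W = limg (R \o phi z))%VS.
  rewrite /W -limg_comp; apply/eqP; rewrite eqEsubv; apply/andP; split.
    apply/subvP => v /memv_imgP[y _ ->]; rewrite !comp_lfunE evE jet2_skew.
    by rewrite memvN -(comp_lfunE R) memv_img ?memvf.
  apply/subvP => v /memv_imgP[y _ ->]; rewrite comp_lfunE -[R _]opprK -jet2_skew.
  by rewrite memvN -evE -(comp_lfunE R) -(comp_lfunE _ phi) memv_img ?memvf.
have kerR : (\dim (limg (phi z) :&: lker R) <= n)%N.
  have -> : n = \dim (ev V x @: T)%VS.
    rewrite limg_dim_eq -?dimT //; apply/separatingP => t tT tx.
    by rewrite -(piK tT) tx linear0.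
  apply: dimvS; apply/subvP => v; rewrite memv_cap memv_ker => /andP[_ /eqP/R_eq0 ->].
  by rewrite -evE memv_img.
have := limg_ker_dim R (limg (phi z)); rewrite -limg_comp.
have := rankT (subvP WT _ (memv_img phi (memvf z))) pz.
by move: kerR; dimlia.
Qed.

Let W_ge : (n.-1 <= \dim W)%N.
Proof.
have /lfunPn[z] := f_neq0; rewrite zero_lfunE -phi_eq0 => pz.
have := dim_N pz; suff : (0 < \dim (N z))%N by dimlia.
rewrite lt0n dimv_eq0; apply: contraNneq pz => Nz.
by rewrite -memv0 -Nz self_N.
Qed.

(** The subspace [lker f + <[z]>] has codimension dim W - 1, and w sends it into Y x. *)
Let rank_add_line (w : 'Hom(U, V)) z (Y : {vspace 'Hom(U, V)}) : f z != 0 ->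
  (forall k, f k = 0 -> exists2 t, t \in Y & w k = t x) ->
  (exists2 t, t \in Y & w z = t x) ->
  (\dim (limg w) <= \dim Y + (\dim W).-1)%N.
Proof.
move=> fz wk wz.
apply: leq_trans (rank_leq_img w (lker f + <[z]>)%VS) _.
have dimM : \dim (lker f + <[z]>)%VS = (\dim (lker f)).+1.
  by rewrite dimv_add_line // memv_ker.
have := limg_ker_dim f fullv; rewrite capfv dimM dimW => fdim.
have le1 : (\dim (w @: (lker f + <[z]>)) <= \dim Y)%N.
  rewrite (leq_trans (_ : _ <= \dim (ev V x @: Y)%VS)%N) //; last first.
    by rewrite -(limg_ker_dim (ev V x) Y) leq_addl.
  apply: dimvS; rewrite limgD subv_add limg_line -memvE; apply/andP; split.
    apply/subvP => v /memv_imgP[k]; rewrite memv_ker => /eqP/wk[t tY tE] ->.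
    by rewrite tE -evE memv_img.
  by case: wz => t tY ->; rewrite -evE memv_img.
have := dimvS (subvf (lker f + <[z]>)%VS); rewrite dimM.
by move: fdim le1; dimlia.
Qed.

(* If W = T then every [phi z] maps [lker f + <z>] into [N z] evaluated at x, so
   [N z] has codimension at most 1 in T and dimension at most 2; two such spaces
   then meet in some [phi z] whose own [N z] is too large. *)
Let W_proper : \dim W != n.
Proof.
apply/eqP => dimWn.
have WTeq : W = T by apply/eqP; rewrite eqEdim WT dimWn dimT leqnn.
have fz_neq0 z : phi z != 0 -> f z != 0 by rewrite phi_eq0.
have N_ge z : phi z != 0 -> (n.-1 <= \dim (N z))%N.
  move=> pz; have pzT : phi z \in T by rewrite phiE.
  have := rankT pzT pz.
  have := @rank_add_line (phi z) z (N z) (fz_neq0 _ pz); rewrite dimWn.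
  have Wpi v : pi v \in W by rewrite WTeq.
  suff [h1 h2] : (forall k, f k = 0 -> exists2 t, t \in N z & phi z k = t x) /\
         (exists2 t, t \in N z & phi z z = t x).
    by move=> /(_ h1 h2); dimlia.
  split=> [k fk|]; last first.
    exists (pi (phi z z)); last by apply: R_eq0; rewrite phiE jet2.
    by rewrite mem_N Wpi phiE jet3 eqxx.
  exists (pi (phi z k)); last by apply: R_eq0; rewrite W_ker // WTeq.
  rewrite mem_N Wpi /=.
  (* Adding k does not change [phi z], so in the expansion of [jet3] at z + k all terms but
     [R (pi (phi z k) z)] vanish, by [jet3] at z and [W_ker]. *)
  have pzk : pi (f (z + k)) = phi z by rewrite [f _]linearD /= fk addr0 phiE.
  have := jet3 (z + k); rewrite pzk [phi z _]linearD [pi _]linearD /= add_lfunE.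
  rewrite [pi (phi z z) _]linearD [pi (phi z k) _]linearD /= !linearD /=.
  rewrite {1}phiE jet3 (W_ker (Wpi _) fk) (W_ker (Wpi _) fk) add0r addr0 add0r => ->.
  by rewrite eqxx.
have N_le z : phi z != 0 -> (\dim (N z) <= 2)%N.
  by move=> /dim_N; rewrite dimWn; dimlia.
have /lfunPn[z1] := f_neq0; rewrite zero_lfunE -phi_eq0 => pz1.
have /subvPn[t2 t2W t2N] : ~~ (W <= N z1)%VS.
  by apply/negP => /dimvS; have := N_le _ pz1; rewrite dimWn; dimlia.
have [z2 t2E] := in_W t2W; rewrite -{t2}t2E in t2W t2N.
have pz2 : phi z2 != 0 by apply: contraNneq t2N => ->; rewrite mem0v.
have N12 : (N z1 :&: N z2)%VS != 0%VS.
  rewrite -dimv_eq0 -lt0n; have := dimv_sum_cap (N z1) (N z2).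
  have : (\dim (N z1 + N z2) <= n)%N.
    by rewrite -dimWn dimvS // subv_add !capvSl.
  by have := N_ge _ pz1; have := N_ge _ pz2; dimlia.
have := memv_pick (N z1 :&: N z2)%VS; rewrite -vpick0 in N12.
move: N12; set u := vpick _ => u_neq0; rewrite memv_cap => /andP[uN1 uN2].
have uW : u \in W by move: uN1; rewrite mem_N => /andP[].
have [z uE] := in_W uW; rewrite -uE in u_neq0 uN1 uN2.
have skewN a b : phi a \in N b -> phi b \in N a.
  by rewrite !mem_N !memv_img ?memvf //= jet2_skew oppr_eq0.
have R12 : R (phi z2 z1) != 0 by move: t2N; rewrite mem_N t2W.
suff : (3 <= \dim (N z))%N by rewrite leqNgt ltnS (N_le _ u_neq0).
(* Independence is read off the form: [phi z] is orthogonal to z1 and z2, while [phi z2] is not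
   orthogonal to z1. *)
have fr : free [:: phi z1; phi z2; phi z].
  have Nz1 : R (phi z z1) = 0 by move: uN1; rewrite mem_N => /andP[_ /eqP].
  have Nz2 : R (phi z z2) = 0 by move: uN2; rewrite mem_N => /andP[_ /eqP].
  rewrite !free_cons span_nil nil_free andbT memv0 u_neq0 andbT.
  apply/andP; split; last first.
    rewrite span_seq1; apply/vlineP => -[c E]; case/eqP: R12.
    by rewrite E scale_lfunE linearZ /= Nz1 scaler0.
  rewrite span_cons span_seq1; apply/negP.
  case/memv_addP => v /vlineP[c ->] [v' /vlineP[c' ->]].
  move=> E; have := jet2_skew z2 z1.
  rewrite E add_lfunE !scale_lfunE linearD !linearZ /= Nz2 scaler0 addr0.
  by rewrite phiE jet2 scaler0 oppr0 => R0; rewrite phiE R0 eqxx in R12.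
rewrite -[3%N]/(size [:: phi z1; phi z2; phi z]) -(eqP fr) dimvS //.
apply/span_subvP => v; rewrite !inE => /or3P[]/eqP ->; rewrite ?self_N //; exact: skewN.
Qed.

Let dimWn : \dim W = n.-1.
Proof. by have := dimvS WT; move: W_proper W_ge; rewrite dimT; dimlia. Qed.

Lemma rank_local : \dim (limg f) = n.-1.
Proof. by rewrite -dimW. Qed.

(** With dim W = n - 1, [dim_N] leaves room for one dimension only, which [phi z] fills. *)
Let N_line z t : phi z != 0 -> t \in N z -> t \in <[phi z]>%VS.
Proof.
move=> pz; suff -> : N z = <[phi z]>%VS by [].
apply/esym/eqP; rewrite eqEdim -memvE self_N dim_vline pz /=.
by have := dim_N pz; rewrite dimWn; dimlia.
Qed.

(* If [w k] left [limg f], moving z along k and x would give [w z = 0] with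
   [phi z = w]; then [w] would map [lker f + <z>] onto at most a plane. *)
Let W_img w k : w \in W -> f k = 0 -> w k \in limg f.
Proof.
move=> wW fk; have [-> |w_neq0] := eqVneq w 0; first by rewrite zero_lfunE mem0v.
have Tx t k' : t \in W -> f k' = 0 -> t k' = pi (t k') x.
  by move=> tW fk'; apply: R_eq0; rewrite W_ker.
have [z0 pz0] := in_W wW.
case: (boolP (pi (w k) \in W)) => [/in_W[y py]|s_notin].
  by rewrite Tx // -py -fE memv_img ?memvf.
suff : (\dim (limg w) <= n)%N by have := rankT (subvP WT _ wW) w_neq0; dimlia.
set s := pi (w k) in s_notin.
have WsT : (W + <[s]> = T)%VS.
  apply/eqP; rewrite eqEdim subv_add WT -memvE piT /= dimv_add_line // dimWn dimT.
  by dimlia.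
have [z [pz wz]] : exists z, phi z = w /\ w z = 0.
  have : pi (w z0) \in (W + <[s]>)%VS by rewrite WsT.
  case/memv_addP => w1 w1W [_ /vlineP[c ->] E].
  have pk : phi k = 0 by apply/eqP; rewrite phi_eq0 fk.
  have px : phi x = 0 by apply/eqP; rewrite phi_eq0 fx0.
  (* Subtracting c k removes the s-component of [pi (w z0)]. Then [pi (w z1)] lies in W, hence by
     [jet3] in [N z1], the line of w; subtracting a multiple of x finally annihilates the value of
     w. *)
  pose z1 := z0 - c *: k.
  have pz1 : phi z1 = w by rewrite linearB linearZ /= pk scaler0 subr0.
  have psi1 : pi (w z1) = w1.
    by rewrite linearB linearZ /= linearB linearZ /= E -/s addrK.
  have : w1 \in N z1.
    by rewrite mem_N w1W -psi1 -pz1 phiE jet3 eqxx.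
  move/N_line; rewrite pz1 => /(_ w_neq0)/vlineP[d w1E].
  exists (z1 - d *: x); split.
    by rewrite linearB linearZ /= px scaler0 subr0.
  rewrite linearB linearZ /=.
  have -> : w z1 = pi (w z1) x by apply: R_eq0; rewrite -{1}pz1 phiE jet2.
  by rewrite psi1 w1E scale_lfunE subrr.
have pz_neq0 : phi z != 0 by rewrite pz.
(* Since w z = 0, [jet3] at z + k' reduces to orthogonality of [pi (w k')] and z. *)
have line k' : f k' = 0 -> pi (w k') \in W -> pi (w k') \in <[w]>%VS.
  move=> fk' w'W; rewrite -[in <[_]>%VS]pz; apply: N_line => //.
  have pzk : pi (f (z + k')) = w by rewrite [f _]linearD /= fk' addr0 -phiE pz.
  rewrite mem_N w'W /=; have := jet3 (z + k').
  rewrite pzk [w (z + k')]linearD /= wz add0r [pi (w k') (z + k')]linearD linearD /=.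
  by rewrite (W_ker w'W fk') addr0 => ->.
(* This bounds the rank of w by 2 + (n - 2) = n, which is below 2n - 2 because n is at least 3. *)
have := @rank_add_line w z (<[w]> + <[s]>)%VS; rewrite -phi_eq0 => /(_ pz_neq0).
have le2 : (\dim (<[w]> + <[s]>)%VS <= 2)%N.
  apply: leq_trans (dimv_add_leqif _ _) _; rewrite !dim_vline.
  by case: (w != 0); case: (s != 0).
rewrite dimWn => H; apply: leq_trans (H _ _) _; last by move: le2; dimlia.
  move=> k' fk'; exists (pi (w k')); last exact: Tx.
  have : pi (w k') \in (W + <[s]>)%VS by rewrite WsT.
  case/memv_addP => w1 w1W [_ /vlineP[c ->] E].
  have fkk : f (k' - c *: k) = 0 by rewrite linearB linearZ /= fk fk' scaler0 subr0.
  have E1 : pi (w (k' - c *: k)) = w1.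
    by rewrite linearB linearZ /= linearB linearZ /= E -/s addrK.
  rewrite E memv_add ?memvZ ?memv_line // -E1 line // E1 //.
by exists 0; rewrite ?mem0v // wz zero_lfunE.
Qed.

Lemma local_structure : exists W' : {vspace 'Hom(U, V)},
  [/\ (W' <= T)%VS, \dim W' = n.-1
    & forall w k, w \in W' -> k \in lker f -> w k \in limg f].
Proof.
exists W; split=> // w k wW; rewrite memv_ker => /eqP fk; exact: W_img.
Qed.

End LocalStructure.

(** * Two special operators in the reflexive closure, from two separating vectors *)

Lemma special_operator (K : fieldType) (U V : vectType K)
    (T : {vspace 'Hom(U, V)}) (n : nat) (s : seq K) (g : 'Hom(U, V)) (x : U) :
    \dim T = n -> (3 <= n)%N -> uniq s -> (n < size s)%N ->
    (forall t, t \in T -> t != 0 -> (2 * n - 2 <= \dim (limg t))%N) ->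
    in_reflexive_closure T g -> g \notin T -> separating T x ->
  exists f (W : {vspace 'Hom(U, V)}),
    [/\ g - f \in T, f x = 0, \dim (limg f) = n.-1
      & [/\ (W <= T)%VS, \dim W = n.-1
          & forall w k, w \in W -> k \in lker f -> w k \in limg f]].
Proof.
move=> dimT n_ge3 s_uniq s_big rankT clos_g gT sepx.
have [pi [piT piK]] := eval_retraction sepx.
have [t tT gx] := clos_g x; pose f := g - t.
have fx0 : f x = 0 by rewrite add_lfunE opp_lfunE gx subrr.
have f_neq0 : f != 0 by rewrite subr_eq0; apply: contraNneq gT => ->.
have dep u : exists t a, [/\ t \in T, (t != 0) || (a != 0) & t u + a *: f u = 0].
  have [t' t'T gu] := clos_g u; exists (t - t'), 1; rewrite memvB // oner_eq0 orbT.
  by rewrite scale1r !add_lfunE !opp_lfunE gu addrA subrK addrN.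
have s_bigT : (\dim T < size s)%N by rewrite dimT.
have jet y := jet_conditions piT piK fx0 s_uniq s_bigT dep y.
have jet1 y : residue x pi (f y) = 0 by case: (jet y).
have jet2 y : residue x pi (pi (f y) y) = 0 by case: (jet y).
have jet3 y : residue x pi (pi (pi (f y) y) y) = 0 by case: (jet y).
have phiE y : (pi \o f)%VF y = pi (f y) by rewrite comp_lfunE.
have rank_f := rank_local dimT n_ge3 rankT piT piK (@residue_eq0 _ _ _ x pi)
  f_neq0 jet1 jet2 jet3 phiE.
have [W WP] := local_structure dimT n_ge3 rankT piT piK (@residue_eq0 _ _ _ x pi)
  fx0 f_neq0 jet1 jet2 jet3 phiE.
by exists f, W; split=> //; rewrite /f opprB addrC subrK.
Qed.

Lemma operator_pair (K : fieldType) (U V : vectType K)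
    (T : {vspace 'Hom(U, V)}) (n : nat) (s : seq K) (h : 'Hom(U, V)) :
    \dim T = n -> (3 <= n)%N -> uniq s -> (n < size s)%N ->
    (forall t, t \in T -> t != 0 -> (2 * n - 2 <= \dim (limg t))%N) ->
    in_reflexive_closure T h -> h \notin T ->
  exists f g (Wf Wg : {vspace 'Hom(U, V)}),
    [/\ f \notin T, f - g \in T, f != g, in_reflexive_closure T f &
    [/\ \dim (limg f) = n.-1, (Wf <= T)%VS, \dim Wf = n.-1
      & forall w k, w \in Wf -> k \in lker f -> w k \in limg f] /\
    [/\ \dim (limg g) = n.-1, (Wg <= T)%VS, \dim Wg = n.-1
      & forall w k, w \in Wg -> k \in lker g -> w k \in limg g]].
Proof.
move=> dimT n_ge3 s_uniq s_big rankT clos_h hT.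
have s_bigT : (\dim T < size s)%N by rewrite dimT.
have [|x sepx] := exists_separating s_uniq s_bigT.
  by move=> t tT /(rankT t tT); apply: leq_trans; rewrite dimT; lia.
have [f [Wf [hf fx0 rank_f [WfT dimWf Wf_img]]]] :=
  special_operator dimT n_ge3 s_uniq s_big rankT clos_h hT sepx.
have fT : f \notin T by apply: contra hT => fT; rewrite -[h](subrK f) memvD.
have clos_f : in_reflexive_closure T f.
  move=> y; have [t tT hy] := clos_h y; exists (t - (h - f)); first exact: memvB.
  by rewrite !add_lfunE !opp_lfunE add_lfunE opp_lfunE hy opprB addrC subrK.
(* With f u non-zero, f does not vanish at c x + u, where g will vanish; this is what separates g
   from f. *)
have /lfunPn[u] : f != 0 by apply: contraNneq fT => ->; rewrite mem0v.
rewrite zero_lfunE => fu.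
have [pi [piT piK]] := eval_retraction sepx.
have [c sepy] := separating_pencil piK u s_uniq s_bigT.
have [g [Wg [fg gy0 rank_g [WgT dimWg Wg_img]]]] :=
  special_operator dimT n_ge3 s_uniq s_big rankT clos_f fT sepy.
exists f, g, Wf, Wg; split=> //.
apply: contraNneq fu => fgE; move: gy0.
by rewrite -fgE linearD linearZ /= fx0 scaler0 add0r => ->.
Qed.

(** * Block decomposition of U and V, and the off-diagonal operators *)

Section Assembly.
Variables (K : fieldType) (U V : vectType K) (T : {vspace 'Hom(U, V)}) (n : nat).
Hypotheses (dimT : \dim T = n) (redT : reduced T) (n_ge3 : (3 <= n)%N).
Hypothesis rankT :
  forall t, t \in T -> t != 0 -> (2 * n - 2 <= \dim (limg t))%N.
Variables (f g : 'Hom(U, V)) (Wf Wg : {vspace 'Hom(U, V)}).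
Hypotheses (fT : f \notin T) (fgT : f - g \in T) (f_neq_g : f != g).
Hypotheses (rank_f : \dim (limg f) = n.-1) (WfT : (Wf <= T)%VS)
  (dimWf : \dim Wf = n.-1)
  (Wf_img : forall w k, w \in Wf -> k \in lker f -> w k \in limg f).
Hypotheses (rank_g : \dim (limg g) = n.-1) (WgT : (Wg <= T)%VS)
  (dimWg : \dim Wg = n.-1)
  (Wg_img : forall w k, w \in Wg -> k \in lker g -> w k \in limg g).

Let fg_neq0 : f - g != 0. Proof. by rewrite subr_eq0. Qed.

Let gT : g \notin T.
Proof. by apply: contra fT => gT; rewrite -[f](subrK g) memvD. Qed.

Let rank_fg : (2 * n - 2 <= \dim (limg (f - g)%R))%N.
Proof. exact: rankT. Qed.

(** Both kernels have codimension n - 1, and their intersection lies in the kernel of f - g, of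
    codimension at least 2n - 2. *)
Lemma lker_pair_full : (lker f + lker g)%VS = fullv.
Proof.
apply/eqP; rewrite eqEdim subvf /=.
have cap_ker : (\dim (lker f :&: lker g) <= \dim (lker (f - g)%R))%N.
  apply: dimvS; apply/subvP => u; rewrite memv_cap !memv_ker add_lfunE opp_lfunE.
  by case/andP=> /eqP -> /eqP ->; rewrite subr0.
have := limg_ker_dim f fullv; have := limg_ker_dim g fullv.
have := limg_ker_dim (f - g) fullv; have := dimv_sum_cap (lker f) (lker g).
rewrite !capfv rank_f rank_g; move: cap_ker rank_fg n_ge3; dimlia.
Qed.

Lemma limg_pair_cap : (limg f :&: limg g = 0)%VS.
Proof.
apply/eqP; rewrite -dimv_eq0.
have le_sum : (\dim (limg (f - g)%R) <= \dim (limg f + limg g)%VS)%N.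
  apply: dimvS; apply/subvP => v /memv_imgP[u _ ->].
  by rewrite add_lfunE opp_lfunE memv_add ?memvN ?memv_img ?memvf.
have := dimv_sum_cap (limg f) (limg g); rewrite rank_f rank_g.
by move: le_sum rank_fg n_ge3; dimlia.
Qed.

Let extend_img (W : {vspace 'Hom(U, V)}) h :
  (forall w k, w \in W -> k \in lker h -> w k \in limg h) ->
  forall w k, w \in (W + <[h]>)%VS -> k \in lker h -> w k \in limg h.
Proof.
move=> Wimg w k /memv_addP[w' w'W [_ /vlineP[c ->] ->]] kh.
rewrite add_lfunE scale_lfunE; apply: memvD; first exact: Wimg.
by rewrite memvZ // memv_img ?memvf.
Qed.

(* In the decompositions U = lker g + lker f and V = limg f + limg g, f and g are
   the diagonal blocks and these operators have zero diagonal. *)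
Definition off_diagonal := ((Wf + <[f]>) :&: (Wg + <[g]>))%VS.

Lemma off_diagonal_f a k : a \in off_diagonal -> k \in lker f -> a k \in limg f.
Proof. by rewrite memv_cap => /andP[aW _]; exact: (extend_img Wf_img). Qed.

Lemma off_diagonal_g a k : a \in off_diagonal -> k \in lker g -> a k \in limg g.
Proof. by rewrite memv_cap => /andP[_ aW]; exact: (extend_img Wg_img). Qed.

(** Otherwise f would send [lker g] into [limg f :&: limg g], which is zero; as f also kills
    [lker f], it would be zero and so lie in T. *)
Let f_notin : f \notin (Wg + <[g]>)%VS.
Proof.
apply/negP => fW; case/negP: fT; suff -> : f = 0 by rewrite mem0v.
apply/lfunP => u; rewrite zero_lfunE; have := memvf u.
rewrite -lker_pair_full => /memv_addP[k kf [k' k'g ->]].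
rewrite linearD /=; move: kf; rewrite memv_ker => /eqP ->; rewrite add0r.
apply/eqP; rewrite -memv0 -limg_pair_cap memv_cap memv_img ?memvf //=.
exact: (extend_img Wg_img).
Qed.

Let g_notin : g \notin (Wf + <[f]>)%VS.
Proof.
apply/negP => gW; case/negP: gT; suff -> : g = 0 by rewrite mem0v.
apply/lfunP => u; rewrite zero_lfunE; have := memvf u.
rewrite -lker_pair_full => /memv_addP[k kf [k' k'g ->]].
rewrite linearD /=; move: k'g; rewrite memv_ker => /eqP ->; rewrite addr0.
apply/eqP; rewrite -memv0 -limg_pair_cap memv_cap memv_img ?memvf // andbT.
exact: (extend_img Wf_img).
Qed.

Lemma off_diagonal_not_f : f \notin off_diagonal.
Proof. by rewrite memv_cap negb_and f_notin orbT. Qed.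

Lemma off_diagonal_not_g : g \notin off_diagonal.
Proof. by rewrite memv_cap negb_and g_notin. Qed.

Let g_in : g \in (T + <[f]>)%VS.
Proof.
have -> : g = - (f - g) + 1 *: f by rewrite scale1r opprB subrK.
by rewrite memv_add ?memvN ?memvZ ?memv_line.
Qed.

Let off_diagonalS : (off_diagonal + <[f]> + <[g]> <= T + <[f]>)%VS.
Proof.
rewrite !subv_add -!memvE g_in (subvP (addvSr _ _) _ (memv_line f)) !andbT.
by rewrite (subv_trans (capvSl _ _)) // addvS.
Qed.

Lemma dim_extended : \dim (T + <[f]>)%VS = n.+1.
Proof. by rewrite dimv_add_line // dimT. Qed.

Let dim_off_diagonal_sum :
  \dim (off_diagonal + <[f]> + <[g]>)%VS = (\dim off_diagonal).+2.
Proof.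
rewrite dimv_add_line ?dimv_add_line ?off_diagonal_not_f //.
apply: contra g_notin; apply/subvP.
by rewrite subv_add capvSl addvSr.
Qed.

(** Two n-dimensional subspaces of [T + <[f]>], whose dimension is n + 1, meet in dimension at least
    n - 1. *)
Let off_diagonal_ge : (n.-1 <= \dim off_diagonal)%N.
Proof.
have le_sum : (\dim ((Wf + <[f]>) + (Wg + <[g]>))%VS <= n.+1)%N.
  rewrite -dim_extended dimvS // !subv_add -!memvE g_in.
  rewrite (subvP (addvSr _ _) _ (memv_line f)) (subv_trans WfT) ?addvSl //.
  by rewrite (subv_trans WgT) ?addvSl.
have := dimv_sum_cap (Wf + <[f]>)%VS (Wg + <[g]>)%VS.
rewrite -/off_diagonal !dimv_add_line ?dimWf ?dimWg.
    have arith m a b : (2 < m -> a <= m.+1 -> a + b = m.-1.+1 + m.-1.+1 ->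
      m.-1 <= b)%N by clear; lia.
    exact: arith le_sum.
  by apply: contra gT; apply/subvP.
by apply: contra fT; apply/subvP.
Qed.

Lemma off_diagonal_full : (off_diagonal + <[f]> + <[g]> = T + <[f]>)%VS.
Proof.
apply/eqP; rewrite eqEdim off_diagonalS dim_extended dim_off_diagonal_sum.
by rewrite ltnS -(ltn_predK n_ge3) ltnS.
Qed.

Lemma dim_off_diagonal : \dim off_diagonal = n.-1.
Proof.
have := dim_extended; rewrite -off_diagonal_full dim_off_diagonal_sum.
by case=> <-.
Qed.

Let mem_extended t : t \in T ->
  exists a c d, a \in off_diagonal /\ t = a + c *: f + d *: g.
Proof.
move=> tT; have : t \in (T + <[f]>)%VS by rewrite (subvP (addvSl _ _)).
rewrite -off_diagonal_full => /memv_addP[_ /memv_addP[a aA [_ /vlineP[c ->] ->]]].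
by case=> _ /vlineP[d ->] ->; exists a, c, d.
Qed.

(** Off-diagonal operators send this intersection into [limg f :&: limg g], which is zero, so all of
    T vanishes on it and reducedness applies. *)
Lemma lker_pair_cap : (lker f :&: lker g = 0)%VS.
Proof.
apply/eqP; rewrite -subv0; apply/subvP => k; rewrite memv_cap memv0 => /andP[kf kg].
apply/eqP; apply: redT.1 => t tT; have [a [c [d [aA ->]]]] := mem_extended tT.
rewrite memv_ker !add_lfunE !scale_lfunE.
move: (kf) (kg); rewrite !memv_ker => /eqP -> /eqP ->; rewrite !scaler0 !addr0.
by rewrite -memv0 -limg_pair_cap memv_cap off_diagonal_f ?off_diagonal_g.
Qed.

Lemma limg_pair_full : (limg f + limg g)%VS = fullv.
Proof.
apply/eqP; rewrite eqEsubv subvf; apply/subvP => v _.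
have [s sT vs] := redT.2 v; apply: (subvP _ _ vs); rewrite big_seq.
apply: (big_ind (fun X => X <= _)%VS) => [|X Y XS YS|t /sT tT]; first exact: sub0v.
  by rewrite subv_add XS.
apply/subvP => _ /memv_imgP[u _ ->]; have [a [c [d [aA ->]]]] := mem_extended tT.
have : u \in (lker f + lker g)%VS by rewrite lker_pair_full memvf.
case/memv_addP => k kf [k' k'g uE].
have aI : a u \in (limg f + limg g)%VS.
  by rewrite uE linearD /= memv_add ?off_diagonal_f ?off_diagonal_g.
rewrite !add_lfunE !scale_lfunE !memvD // memvZ //.
  by rewrite (subvP (addvSl _ _)) ?memv_img ?memvf.
by rewrite (subvP (addvSr _ _)) ?memv_img ?memvf.
Qed.

Lemma dim_lker_f : \dim (lker f) = n.-1.
Proof.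
have := limg_ker_dim g fullv; have := dimv_sum_cap (lker f) (lker g).
rewrite lker_pair_full lker_pair_cap dimv0 capfv rank_g.
by dimlia.
Qed.

Lemma dim_lker_g : \dim (lker g) = n.-1.
Proof.
have := limg_ker_dim f fullv; have := dimv_sum_cap (lker f) (lker g).
rewrite lker_pair_full lker_pair_cap dimv0 capfv rank_f.
by dimlia.
Qed.

(** U now has dimension 2n - 2, exactly the lower bound on the rank. *)
Let lker_T t : t \in T -> t != 0 -> lker t = 0%VS.
Proof.
move=> tT t0; have := rankT tT t0; have := limg_ker_dim t fullv.
have := limg_ker_dim f fullv; rewrite !capfv rank_f dim_lker_f => E1 E2 E3.
by apply/eqP; rewrite -dimv_eq0; move: E1 E2 E3; dimlia.
Qed.

(* Up to a multiple of [h], a non-zero off-diagonal operator lies in T. *)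
Let off_diagonal_inj h a k :
  h \notin off_diagonal -> h \notin T -> h \in (T + <[f]>)%VS ->
  a \in off_diagonal -> a != 0 -> h k = 0 -> a k = 0 -> k = 0.
Proof.
move=> hA hT hS aA a0 hk ak.
have Th : (T + <[h]> = T + <[f]>)%VS.
  apply/eqP; rewrite eqEdim subv_add addvSl -memvE hS.
  by rewrite dim_extended dimv_add_line // dimT leqnn.
have : a \in (T + <[h]>)%VS.
  rewrite Th (subvP off_diagonalS) // -addvA.
  by rewrite (subvP (addvSl _ _)).
case/memv_addP => t tT [_ /vlineP[c ->] aE].
have t0 : t != 0.
  apply: contraNneq hA => t0; move: aE aA; rewrite t0 add0r => aE.
  have c0 : c != 0 by apply: contraNneq a0 => c0; rewrite aE c0 scale0r.
  by rewrite aE => /(memvZ c^-1); rewrite scalerK.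
apply/eqP; rewrite -memv0 -(lker_T tT t0) memv_ker.
by have /eqP := ak; rewrite aE add_lfunE scale_lfunE hk scaler0 addr0.
Qed.

Lemma off_diagonal_inj_f a k : a \in off_diagonal -> a != 0 ->
  k \in lker f -> a k = 0 -> k = 0.
Proof.
move=> aA a0; rewrite memv_ker => /eqP fk.
apply: (off_diagonal_inj off_diagonal_not_f) => //.
by rewrite (subvP (addvSr _ _)) // memv_line.
Qed.

Lemma off_diagonal_inj_g a k : a \in off_diagonal -> a != 0 ->
  k \in lker g -> a k = 0 -> k = 0.
Proof.
move=> aA a0; rewrite memv_ker => /eqP gk.
by apply: (off_diagonal_inj off_diagonal_not_g).
Qed.

End Assembly.

(** * The LDB division algebra read off the blocks, and the equivalence *)

Section LinComb.
Variables (K : fieldType) (E : vectType K) (n : nat) (e : n.-tuple E).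

Definition lin_comb (r : 'rV[K]_n) : E := \sum_i r 0 i *: e`_i.

Fact lin_comb_is_linear : linear lin_comb.
Proof.
move=> a r r'; rewrite scaler_sumr -big_split; apply: eq_bigr => i _ /=.
by rewrite !mxE scalerDl scalerA.
Qed.

HB.instance Definition _ :=
  GRing.isLinear.Build K 'rV[K]_n E *:%R lin_comb lin_comb_is_linear.

End LinComb.

(** Serves to identify [lker f], [lker g] and [off_diagonal], all of dimension n - 1, with one row
    space, the carrier of the algebra. *)
Lemma vspace_param (K : fieldType) (E : vectType K) (X : {vspace E}) (m : nat) :
  \dim X = m -> exists h : 'Hom('rV[K]_m, E), lker h == 0%VS /\ limg h = X.
Proof.
move=> <-; pose h : 'Hom('rV[K]_(\dim X), E) :=
  linfun (lin_comb (vbasis X)).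
have hE r : h r = \sum_i r 0 i *: (vbasis X)`_i by rewrite lfunE.
have X_free : free (vbasis X) by apply: basis_free (vbasisP X).
exists h; split.
  apply/lker0P => u v; rewrite !hE => E1; apply/rowP => i.
  by rewrite -(coord_sum_free (fun i => u 0 i) i X_free) E1 coord_sum_free.
apply/eqP; rewrite eqEsubv; apply/andP; split; apply/subvP => v.
  case/memv_imgP => r _ ->; rewrite hE; apply: rpred_sum => i _.
  by rewrite memvZ // vbasis_mem // mem_nth // size_tuple.
move=> vX; have -> : v = h (\row_i coord (vbasis X) i v).
  by rewrite hE {1}(coord_vbasis vX); apply: eq_bigr => i _; rewrite mxE.
by rewrite memv_img ?memvf.
Qed.

Section TwistProduct.
Variables (K : fieldType) (U V A B C : vectType K).
Variables (p : 'Hom(V, C)) (tau : 'Hom(A, 'Hom(U, V))) (b : 'Hom(B, U)).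

(** Common form of both products: x names an operator, b embeds its argument and p takes coordinates
    of the value. *)
Definition lfun_prod (x : A) (z : B) : C := p (tau x (b z)).

Fact lfun_prod_is_bilinear : bilinear_for *:%R *:%R lfun_prod.
Proof.
split=> u a x y; rewrite /lfun_prod; last by rewrite !linearP.
by rewrite linearP add_lfunE scale_lfunE linearP.
Qed.

HB.instance Definition _ :=
  bilinear_isBilinear.Build K A B C *:%R *:%R lfun_prod lfun_prod_is_bilinear.

End TwistProduct.

Lemma twisted_opE (K : fieldType) (D : ldb_division_algebra K) p w :
  @twisted_op K D p w = twisted_fun p w.
Proof. exact: lfunE. Qed.

Lemma mem_twisted_op (K : fieldType) (D : ldb_division_algebra K) p :
  @twisted_op K D p \in twisted_space D.
Proof. by apply/memv_imgP; exists p; [exact: memvf | rewrite lfunE]. Qed.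

Lemma twisted_space_op (K : fieldType) (D : ldb_division_algebra K) h :
  h \in twisted_space D -> exists p, h = @twisted_op K D p.
Proof. by case/memv_imgP => p _ ->; exists p; rewrite lfunE. Qed.

Section Construction.
Variables (K : fieldType) (U V : vectType K) (T A : {vspace 'Hom(U, V)}) (m : nat).
Variables (f g : 'Hom(U, V)).
Hypotheses (m_gt0 : (0 < m)%N) (fT : f \notin T).
Hypothesis f_clos : in_reflexive_closure T f.
Hypotheses (ker_full : (lker f + lker g = fullv)%VS)
  (ker_cap : (lker f :&: lker g = 0)%VS).
Hypotheses (img_full : (limg f + limg g = fullv)%VS)
  (img_cap : (limg f :&: limg g = 0)%VS).
Hypotheses (dim_kf : \dim (lker f) = m) (dim_kg : \dim (lker g) = m)
  (dimA : \dim A = m).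
Hypothesis Af : forall a k, a \in A -> k \in lker f -> a k \in limg f.
Hypothesis Ag : forall a k, a \in A -> k \in lker g -> a k \in limg g.
Hypothesis Af_inj :
  forall a k, a \in A -> a != 0 -> k \in lker f -> a k = 0 -> k = 0.
Hypothesis Ag_inj :
  forall a k, a \in A -> a != 0 -> k \in lker g -> a k = 0 -> k = 0.
Hypothesis A_full : (A + <[f]> + <[g]> = T + <[f]>)%VS.
Hypothesis dim_Tf : \dim (T + <[f]>)%VS = (\dim T).+1.

Local Notation C := 'rV[K]_m.
Variables (alpha beta : 'Hom(C, U)) (tau : 'Hom(C, 'Hom(U, V))).
Hypotheses (alpha0 : lker alpha == 0%VS) (alpha_img : limg alpha = lker g).
Hypotheses (beta0 : lker beta == 0%VS) (beta_img : limg beta = lker f).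
Hypotheses (tau0 : lker tau == 0%VS) (tau_img : limg tau = A).

(** P and Q are coordinates on [limg f] and [limg g] in which the diagonal blocks f and g become
    identities. *)
Let P := (f \o alpha)%VF.
Let Q := (g \o beta)%VF.

Let alpha_g y : alpha y \in lker g. Proof. by rewrite -alpha_img memv_img ?memvf. Qed.
Let beta_f z : beta z \in lker f. Proof. by rewrite -beta_img memv_img ?memvf. Qed.
Let tauA x : tau x \in A. Proof. by rewrite -tau_img memv_img ?memvf. Qed.
Let g_alpha y : g (alpha y) = 0. Proof. by apply/eqP; rewrite -memv_ker. Qed.
Let f_beta y : f (beta y) = 0. Proof. by apply/eqP; rewrite -memv_ker. Qed.

Let inj0 (E : vectType K) (h : 'Hom(C, E)) x : lker h == 0%VS -> h x = 0 -> x = 0.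
Proof. by move/eqP=> h0 hx; apply/eqP; rewrite -memv0 -h0 memv_ker hx. Qed.

Let ker0 (E F : vectType K) (h : 'Hom(E, F)) :
  (forall x, h x = 0 -> x = 0) -> lker h == 0%VS.
Proof.
move=> h0; rewrite -subv0; apply/subvP => x.
by rewrite memv_ker memv0 => /eqP/h0 ->.
Qed.

Let P0 : lker P == 0%VS.
Proof.
apply: ker0 => y; rewrite comp_lfunE => fy; apply: (inj0 alpha0); apply/eqP.
by rewrite -memv0 -ker_cap memv_cap alpha_g memv_ker fy eqxx.
Qed.

Let Q0 : lker Q == 0%VS.
Proof.
apply: ker0 => y; rewrite comp_lfunE => gy; apply: (inj0 beta0); apply/eqP.
by rewrite -memv0 -ker_cap memv_cap beta_f memv_ker gy eqxx.
Qed.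

Let P_img : limg P = limg f.
Proof.
rewrite /P limg_comp alpha_img -ker_full limgD.
have /eqP -> : (f @: lker f == 0)%VS by rewrite -lkerE.
by rewrite add0v.
Qed.

Let Q_img : limg Q = limg g.
Proof.
rewrite /Q limg_comp beta_img -ker_full limgD.
have /eqP -> : (g @: lker g == 0)%VS by rewrite -lkerE.
by rewrite addv0.
Qed.

(** [P^-1] is a true inverse only on [limg f], where [Af] keeps the values [tau x (beta z)];
    likewise for [Q^-1] and [Ag]. *)
Definition tw_star : {bilinear C -> C -> C} := lfun_prod (P^-1)%VF tau beta.
Definition tw_bullet : {bilinear C -> C -> C} := lfun_prod (Q^-1)%VF tau alpha.

Let P_star x z : P (tw_star x z) = tau x (beta z).
Proof. by rewrite /tw_star /= /lfun_prod limg_lfunVK // P_img Af. Qed.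

Let Q_bullet x y : Q (tw_bullet x y) = tau x (alpha y).
Proof. by rewrite /tw_bullet /= /lfun_prod limg_lfunVK // Q_img Ag. Qed.

Lemma tw_star_regular : regular_product tw_star.
Proof.
move=> x z x0 z0; apply: contraNneq z0 => xz; apply/eqP/(inj0 beta0).
apply: (Af_inj (tauA x)) => //; last by rewrite -P_star xz linear0.
by apply: contraNneq x0 => /(inj0 tau0) ->.
Qed.

Lemma tw_bullet_eq0 x y : tw_bullet x y = 0 <-> x = 0 \/ y = 0.
Proof.
split=> [xy|[->|->]]; last 2 first.
- by rewrite linear0l.
- by rewrite linear0r.
have [->|x0] := eqVneq x 0; [by left | right].
apply: (inj0 alpha0); apply: (Ag_inj (tauA x)) => //; last by rewrite -Q_bullet xy linear0.
by apply: contraNneq x0 => /(inj0 tau0) ->.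
Qed.

Let mem_span3 t : t \in (T + <[f]>)%VS ->
  exists x c d, t = tau x + c *: f + d *: g.
Proof.
rewrite -A_full => /memv_addP[_ /memv_addP[a aA [_ /vlineP[c ->] ->]]].
case=> _ /vlineP[d ->] ->.
by move: aA; rewrite -tau_img => /memv_imgP[x _ ->]; exists x, c, d.
Qed.

(** This is the action of a twisted operator, read in the coordinates [alpha], [beta] on U and [P],
    [Q] on V. *)
Let eval3 x c d y z : (tau x + c *: f + d *: g) (alpha y + beta z) =
  P (tw_star x z + c *: y) + Q (tw_bullet x y + d *: z).
Proof.
have fu : f (alpha y + beta z) = P y by rewrite linearD /= f_beta addr0 comp_lfunE.
have gu : g (alpha y + beta z) = Q z by rewrite linearD /= g_alpha add0r comp_lfunE.
rewrite !add_lfunE !scale_lfunE fu gu [tau x _]linearD /= -P_star -Q_bullet.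
rewrite [P (_ + _)]linearD [Q (_ + _)]linearD /= [P (c *: _)]linearZ [Q (d *: _)]linearZ /=.
by rewrite [Q _ + P _]addrC -!addrA; congr (_ + _); rewrite addrCA.
Qed.

Let PQ0 u v : P u + Q v = 0 -> u = 0 /\ v = 0.
Proof.
move=> E; have E' : P u = - Q v by apply/eqP; rewrite -addr_eq0 E.
have Pu : P u = 0.
  apply/eqP; rewrite -memv0 -img_cap memv_cap -{1}P_img memv_img ?memvf //=.
  by rewrite E' -Q_img memvN memv_img ?memvf.
split; first exact: inj0 P0 Pu.
by apply: (inj0 Q0); rewrite -[LHS]opprK -E' Pu oppr0.
Qed.

(* Any vector (y, x . y) is killed by some non-zero x' + c f + d g, and
   regularity forces x' = - d x. *)
Lemma tw_collinear x y : ~~ free [:: tw_star x (tw_bullet x y); y].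
Proof.
rewrite free_cons seq1_free span_seq1 negb_and !negbK.
have [->|y0] := eqVneq y 0; first by rewrite orbT.
have [->|x0] := eqVneq x 0; first by rewrite linear0l mem0v.
rewrite orbF; set z := tw_bullet x y.
have [t tT ft] := f_clos (alpha y + beta z).
have : f - t \in (T + <[f]>)%VS.
  by rewrite memvB // ?(subvP (addvSr _ _) _ (memv_line f)) // (subvP (addvSl _ _)).
case/mem_span3 => x' [c [d E]].
have : (f - t) (alpha y + beta z) = 0 by rewrite add_lfunE opp_lfunE ft subrr.
rewrite E eval3 => /PQ0[E1 E2].
have x'E : x' = - (d *: x).
  apply/eqP; rewrite -addr_eq0; apply/eqP.
  have : tw_bullet (x' + d *: x) y = 0 by rewrite linearDl linearZl_LR.
  by case/tw_bullet_eq0 => // y00; rewrite y00 eqxx in y0.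
have Edc : d *: tw_star x z = c *: y.
  move: E1; rewrite x'E linearNl linearZl_LR /= addrC => /eqP.
  by rewrite subr_eq0 => /eqP.
(* When d = 0, also c = 0 and x' = 0, so f would equal t and lie in T. *)
have [d0|d0] := eqVneq d 0; last first.
  by rewrite -[tw_star x z](scalerK d0) Edc !memvZ ?memv_line.
move: Edc; rewrite d0 scale0r => /esym/eqP; rewrite scaler_eq0 (negPf y0) orbF => /eqP c0.
case/negP: fT; move: E; rewrite x'E d0 c0 !scale0r oppr0 linear0 !addr0 => /eqP.
by rewrite subr_eq0 => /eqP ->.
Qed.

Fact tw_dim_gt0 : (0 < \dim {: C})%N.
Proof. by rewrite dimvf dim_matrix mul1r. Qed.

Definition tw_algebra : ldb_division_algebra K :=
  LDBDivisionAlgebra tw_dim_gt0 tw_star_regular (conj tw_bullet_eq0 tw_collinear).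

Let Uof (w : C * C) : U := alpha w.1 + beta w.2.
Let Vof (w : C * C) : V := P w.1 + Q w.2.

Let Uof_linear : linear Uof.
Proof. by move=> a u v; rewrite /Uof /= !linearP /= scalerDr addrACA. Qed.
Let Vof_linear : linear Vof.
Proof. by move=> a u v; rewrite /Vof /= !linearP /= scalerDr addrACA. Qed.

HB.instance Definition _ := GRing.isLinear.Build K (C * C)%type U *:%R Uof Uof_linear.
HB.instance Definition _ := GRing.isLinear.Build K (C * C)%type V *:%R Vof Vof_linear.

Let F' : 'Hom((C * C)%type, U) := linfun Uof.
Let G : 'Hom((C * C)%type, V) := linfun Vof.
Let F := (F'^-1)%VF.

Let F'E y z : F' (y, z) = alpha y + beta z. Proof. by rewrite lfunE. Qed.
Let GE y z : G (y, z) = P y + Q z. Proof. by rewrite lfunE. Qed.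

Let F'0 : lker F' == 0%VS.
Proof.
apply: ker0 => -[y z]; rewrite F'E => E.
have E' : alpha y = - beta z by apply/eqP; rewrite -addr_eq0 E.
have ay : alpha y = 0.
  apply/eqP; rewrite -memv0 -ker_cap memv_cap alpha_g andbT.
  by rewrite E' memvN.
have -> : y = 0 by apply: inj0 ay.
by have -> : z = 0 by apply: (inj0 beta0); rewrite -[LHS]opprK -E' ay oppr0.
Qed.

Let F'_full : limg F' = fullv.
Proof.
apply/eqP; rewrite eqEsubv subvf /=.
suff : (limg beta + limg alpha <= limg F')%VS by rewrite alpha_img beta_img ker_full.
rewrite subv_add; apply/andP; split; apply/subvP => _ /memv_imgP[y _ ->].
  by rewrite -[beta y]add0r -(linear0 alpha) -F'E memv_img ?memvf.
by rewrite -[alpha y]addr0 -(linear0 beta) -F'E memv_img ?memvf.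
Qed.

Let F'K u : F' (F u) = u.
Proof. by rewrite limg_lfunVK // F'_full memvf. Qed.

Let FK w : F (F' w) = w.
Proof. exact: lker0_lfunK. Qed.

Let F_iso : lfun_iso F.
Proof.
split; first by apply/eqP/lker0P => u v E; rewrite -[u]F'K E F'K.
apply/eqP; rewrite eqEsubv subvf; apply/subvP => w _.
by rewrite -[w]FK memv_img ?memvf.
Qed.

Let G0 : lker G == 0%VS.
Proof. by apply: ker0 => -[y z]; rewrite GE => /PQ0[-> ->]. Qed.

Let G_iso : lfun_iso G.
Proof.
split; first exact/eqP.
apply/eqP; rewrite eqEsubv subvf /=.
suff : (limg P + limg Q <= limg G)%VS by rewrite P_img Q_img img_full.
rewrite subv_add; apply/andP; split; apply/subvP => _ /memv_imgP[y _ ->].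
  by rewrite -[P y]addr0 -(linear0 Q) -GE memv_img ?memvf.
by rewrite -[Q y]add0r -(linear0 P) -GE memv_img ?memvf.
Qed.

Let transport (h : 'End((C * C)%type)) : 'Hom(U, V) := (G \o h \o F)%VF.

Let transport_linear : linear transport.
Proof.
move=> a h k; apply/lfunP => u.
by rewrite /transport !comp_lfunE !add_lfunE !scale_lfunE !comp_lfunE linearP.
Qed.

HB.instance Definition _ :=
  GRing.isLinear.Build K 'End((C * C)%type) 'Hom(U, V) *:%R transport transport_linear.

Let tr : 'Hom('End((C * C)%type), 'Hom(U, V)) := linfun transport.

Let trE h : tr h = (G \o h \o F)%VF. Proof. by rewrite lfunE. Qed.

Let tr0 : lker tr == 0%VS.
Proof.
apply: ker0 => h; rewrite trE => h0; apply/lfunP => w; rewrite zero_lfunE.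
have : (G \o h \o F)%VF (F' w) = 0 by rewrite h0 zero_lfunE.
rewrite !comp_lfunE FK => Gh; apply/eqP; rewrite -memv0 -(eqP G0) memv_ker.
by rewrite Gh.
Qed.

Let tr_twisted x c d :
  tr (@twisted_op K tw_algebra (x, ((c : K^o), (d : K^o)))) = tau x + c *: f + d *: g.
Proof.
apply/lfunP => u; rewrite trE !comp_lfunE -[in RHS](F'K u).
case: (F u) => y z; rewrite F'E eval3 -GE.
by congr (G _); apply: (@twisted_opE _ tw_algebra).
Qed.

Let tr_img : (tr @: twisted_space tw_algebra = T + <[f]>)%VS.
Proof.
apply/eqP; rewrite eqEsubv; apply/andP; split; apply/subvP => t.
  case/memv_imgP => h hT ->; have [[x [c d]] ->] := @twisted_space_op K tw_algebra h hT.
  rewrite tr_twisted.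
  by rewrite -A_full !memv_add ?memvZ ?memv_line.
case/mem_span3 => x [c [d ->]]; rewrite -tr_twisted memv_img //.
exact: (@mem_twisted_op K tw_algebra).
Qed.

(** The injective map [tr] carries the twisted space onto [T + <[f]>], where T has codimension one;
    the hyperplane is the preimage of T. *)
Lemma tw_equivalence :
  exists (D : ldb_division_algebra K)
         (H : {vspace 'End((ldb_carrier D * ldb_carrier D)%type)}),
    hyperplane_of H (twisted_space D) /\ equivalent_spaces T H.
Proof.
have T_img : (T <= limg tr)%VS.
  by rewrite (subv_trans (addvSl T <[f]>)) // -tr_img limgS ?subvf.
have trH := lpreimK T_img.
exists tw_algebra, (tr @^-1: T)%VS; split.
  split.
    by rewrite -(limg_ker0 _ _ tr0) trH tr_img addvSl.
  have dim_tr X : \dim (tr @: X) = \dim X.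
    by rewrite limg_dim_eq // (eqP tr0) capv0.
  by rewrite -dim_tr tr_img dim_Tf -[in RHS]dim_tr trH.
exists F, G; split=> // t; split=> [tT|[h]].
  have : t \in (tr @: (tr @^-1: T))%VS by rewrite trH.
  by case/memv_imgP => h hT ->; exists h; rewrite // trE.
by rewrite -memv_preim trE => hT ->.
Qed.

End Construction.

Theorem theorem1p1 (K : fieldType) (U V : vectType K) (n : nat)
  (T : {vspace 'Hom(U, V)})
  (dimT : \dim T = n)
  (redT : reduced T)
  (nreflT : ~ reflexive_space T)
  (n_ge3 : (3 <= n)%N)
  (cardK : exists2 s : seq K, uniq s & (n < size s)%N)
  (rankT : forall f, f \in T -> f != 0 -> (2 * n - 2 <= \dim (limg f))%N) :
  exists (D : ldb_division_algebra K)
         (H : {vspace 'End((ldb_carrier D * ldb_carrier D)%type)}),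
    hyperplane_of H (twisted_space D) /\ equivalent_spaces T H.
Proof.
have [s s_uniq s_big] := cardK.
(* T always lies in its reflexive closure, so non-reflexivity can only come from an operator of the
   closure outside T. *)
have [h [clos_h hT]] : exists h, in_reflexive_closure T h /\ h \notin T.
  apply: NNPP => no_h; apply: nreflT => h; split=> [hT x|clos_h]; first by exists h.
  by apply/negPn/negP => hT; apply: no_h; exists h.
have [f [g [Wf [Wg [fT fgT f_neq_g clos_f]]]]] :=
  operator_pair dimT n_ge3 s_uniq s_big rankT clos_h hT.
case=> -[rank_f WfT dimWf Wf_img] [rank_g WgT dimWg Wg_img].
have m_gt0 : (0 < n.-1)%N by move: n_ge3; clear; lia.
have kf := dim_lker_f dimT redT n_ge3 rankT fT fgT f_neq_g rank_f WfT dimWf Wf_img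
  rank_g WgT dimWg Wg_img.
have kg := dim_lker_g dimT redT n_ge3 rankT fT fgT f_neq_g rank_f WfT dimWf Wf_img
  rank_g WgT dimWg Wg_img.
have dimA := dim_off_diagonal dimT n_ge3 rankT fT fgT f_neq_g rank_f WfT dimWf Wf_img
  rank_g WgT dimWg Wg_img.
have [alpha [alpha0 alpha_img]] := vspace_param kg.
have [beta [beta0 beta_img]] := vspace_param kf.
have [tau [tau0 tau_img]] := vspace_param dimA.
apply: (tw_equivalence m_gt0 fT clos_f _ _ _ _ _ _ _ _ _ _
  alpha0 alpha_img beta0 beta_img tau0 tau_img).
- exact: (lker_pair_full n_ge3 rankT fgT f_neq_g rank_f rank_g).
- exact: (lker_pair_cap dimT redT n_ge3 rankT fT fgT f_neq_g rank_f WfT dimWf Wf_img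
    rank_g WgT dimWg Wg_img).
- exact: (limg_pair_full dimT redT n_ge3 rankT fT fgT f_neq_g rank_f WfT dimWf Wf_img
    rank_g WgT dimWg Wg_img).
- exact: (limg_pair_cap n_ge3 rankT fgT f_neq_g rank_f rank_g).
- by move=> a k; apply: off_diagonal_f.
- by move=> a k; apply: off_diagonal_g.
- exact: (off_diagonal_inj_f dimT redT n_ge3 rankT fT fgT f_neq_g rank_f WfT dimWf Wf_img
    rank_g WgT dimWg Wg_img).
- exact: (off_diagonal_inj_g dimT redT n_ge3 rankT fT fgT f_neq_g rank_f WfT dimWf Wf_img
    rank_g WgT dimWg Wg_img).
- exact: (off_diagonal_full dimT n_ge3 rankT fT fgT f_neq_g rank_f WfT dimWf Wf_img
    rank_g WgT dimWg Wg_img).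
- by rewrite (dim_extended dimT fT) dimT.
Qed.
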